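(* Define a map $\psi$ on area sequences recursively: $\psi(\varepsilon) := \varepsilon$ (the empty word), and if $w = ua$ with $u$ a word and $a$ its last letter, $\psi(w) := \operatorname{ins}_{c_a}(\psi(u))$, where $c_0, c_1, \dots, c_k$ are the admissible insertion positions of $\psi(u)$ listed in admissible order. Then $\psi$ is well defined (at each step $a \le k$), it defines a bijection on area sequences (mapping area sequences of size $n$ bijectively onto area sequences of size $n$ for each $n$), and for every area sequence $w$, \[ \operatorname{dinv}(\psi(w)) = \operatorname{area}(w). \]
   Context: An area sequence of size $n$ is a word $w = w_1 \dots w_n$ of nonnegative integers with $w_1 = 0$ and $0 \le w_{i+1} \le w_i + 1$ for $1 \le i < n$ (equivalently, the area sequence of a Dyck path of size $n$); the empty word is the area sequence of size $0$. Its area is $\operatorname{area}(w) = \sum_i w_i$. Dinv: for each $i$, let $d_i$ be the number of indices $j > i$ with $w_j = w_i$ or $w_j = w_i - 1$; $\operatorname{dinv}(w) = \sum_i d_i$. Insertion: $\operatorname{ins}_0(w) := 0 w_1 \dots w_n$, and for $1 \le i \le n$, $\operatorname{ins}_i(w) := w_1 \dots w_i (w_i+1) w_{i+1} \dots w_n$. Admissible insertion positions: for a nonempty area sequence $w$ with maximum value $m$, let $\mathrm{Maxb}(w) = \{ i : w_i = m\}$; let $\mathrm{Maxa}(w)$ be the set of positions $i$ with $w_i = m-1$ and $w_j < m$ for all $j > i$; let $i_0(w)$ be the position of the leftmost letter of the rightmost block of consecutive letters equal to $m$. The admissible insertion positions are $\mathrm{Maxb}(w) \cup \mathrm{Maxa}(w)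 \cup \{i_0(w) - 1\}$, with admissible order: elements of $\mathrm{Maxb}(w)$ in decreasing order, then elements of $\mathrm{Maxa}(w)$ in decreasing order, then $i_0(w)-1$. For the empty word, the only admissible insertion position is $0$. *)

(* Defs.v *)
From mathcomp Require Import all_boot.

Set Implicit Arguments.
Unset Strict Implicit.
Unset Printing Implicit Defensive.

(* Words are [seq nat]; positions are numbered from 1, as in w = w_1 ... w_n. *)
Definition letter (w : seq nat) (i : nat) : nat := nth 0 w i.-1.

Definition positions (w : seq nat) : seq nat := iota 1 (size w).

Definition is_area_seq (w : seq nat) : bool :=
  (head 0 w == 0) && sorted (fun x y => y <= x.+1) w.

Definition area (w : seq nat) : nat := sumn w.

(* w_j = w_i - 1 is an equation between integers, hence the successor on the
   left rather than the truncated predecessor of w_i. *)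
Definition dinv_at (w : seq nat) (i : nat) : nat :=
  count (fun j => (i < j) && ((letter w j == letter w i)
                              || ((letter w j).+1 == letter w i)))
        (positions w).

Definition dinv (w : seq nat) : nat :=
  sumn [seq dinv_at w i | i <- positions w].

Definition ins (i : nat) (w : seq nat) : seq nat :=
  if i == 0 then 0 :: w else take i w ++ (letter w i).+1 :: drop i w.

Definition maxval (w : seq nat) : nat := foldr maxn 0 w.

(* [Maxb] and [Maxa] are listed in increasing order. *)
Definition Maxb (w : seq nat) : seq nat :=
  [seq i <- positions w | letter w i == maxval w].

Definition Maxa (w : seq nat) : seq nat :=
  [seq i <- positions w | ((letter w i).+1 == maxval w)
     && all (fun j => (i < j) ==> (letter w j < maxval w)) (positions w)].

(* Leftmost positions of the blocks of consecutive letters equal to the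
   maximum, from left to right. *)
Definition block_starts (w : seq nat) : seq nat :=
  [seq i <- positions w | (letter w i == maxval w)
     && ((i == 1) || (letter w i.-1 != maxval w))].

Definition i0 (w : seq nat) : nat := last 0 (block_starts w).

(* The admissible insertion positions c_0, ..., c_k, in admissible order. *)
Definition adm_positions (w : seq nat) : seq nat :=
  if w is [::] then [:: 0]
  else rev (Maxb w) ++ rev (Maxa w) ++ [:: (i0 w).-1].

(* The default value of [nth] is used only if a > k. *)
Definition psi_step (v : seq nat) (a : nat) : seq nat :=
  ins (nth 0 (adm_positions v) a) v.

Definition psi (w : seq nat) : seq nat := foldl psi_step [::] w.

Lemma psi_nil : psi [::] = [::].
Proof. by []. Qed.

Lemma psi_rcons (u : seq nat) (a : nat) :
  psi (rcons u a) = ins (nth 0 (adm_positions (psi u)) a) (psi u).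
Proof. by rewrite /psi foldl_rcons. Qed.

Definition bijection_on (T : Type) (P : T -> Prop) (f : T -> T) : Prop :=
  [/\ forall x, P x -> P (f x),
      forall x y, P x -> P y -> f x = f y -> x = y
    & forall y, P y -> exists2 x, P x & f x = y].

(* Main.v *)
Require Import Defs.
From mathcomp Require Import all_boot.
From mathcomp Require Import zify.

Set Implicit Arguments.
Unset Strict Implicit.
Unset Printing Implicit Defensive.

(* The letter inserted at an admissible position is always maximal in the new
   word and starts its last block of maximal letters, so [psi] is undone by
   repeatedly deleting that letter. If x is this letter and the new word is
   p x q, then the letters x of p and q together with the letters x - 1 of q
   number exactly a, where a is the rank of the position in the admissible order;
   these are also the pairs that the insertion adds to dinv, and the new word has
   a + 2 admissible positions. Hence the next letter may be anything up to a + 1,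
   which is the condition defining area sequences. *)

(* [ins (size p) (p ++ q) = p ++ cap p :: q], including for [p] empty. *)
Definition cap (p : seq nat) : nat := last 0 (map succn p).

Lemma cap_rcons p x : cap (rcons p x) = x.+1.
Proof. by rewrite /cap map_rcons last_rcons. Qed.

Lemma cap_take w c : 0 < c <= size w -> cap (take c w) = (letter w c).+1.
Proof.
case: c => [|c] //= ltc.
by rewrite (take_nth 0 ltc) cap_rcons.
Qed.

Lemma ins_split c w :
  c <= size w -> ins c w = take c w ++ cap (take c w) :: drop c w.
Proof.
rewrite /ins; case: c => [|c] lec /=; first by rewrite take0 drop0.
by rewrite cap_take.
Qed.

Lemma ins_cat p q : ins (size p) (p ++ q) = p ++ cap p :: q.
Proof.
by rewrite ins_split ?size_cat ?leq_addr // take_size_cat // drop_size_cat.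
Qed.

(** * Area sequences as paths *)

Definition step_rel (x y : nat) : bool := y <= x.+1.

(** Raising every letter by one turns the condition on the first letter into an ordinary step from
    0. The path then ends at [cap w], so area sequences concatenate like paths. *)
Lemma is_area_seqE w : is_area_seq w = path step_rel 0 (map succn w).
Proof.
case: w => [|x w] //; rewrite /is_area_seq /=; congr (_ && _).
  by rewrite /step_rel ltnS leqn0.
by rewrite path_map; apply: eq_path => a b; rewrite /step_rel /= ltnS.
Qed.

Lemma area_seq_rcons u a :
  is_area_seq (rcons u a) = is_area_seq u && (a <= cap u).
Proof. by rewrite !is_area_seqE map_rcons rcons_path /step_rel ltnS. Qed.

Lemma area_seq_cat p q :
  is_area_seq (p ++ q) = is_area_seq p && path step_rel (cap p) (map succn q).
Proof. by rewrite !is_area_seqE map_cat cat_path. Qed.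

Lemma area_seq_ins p q :
  is_area_seq (p ++ q) -> is_area_seq (p ++ cap p :: q).
Proof.
rewrite !area_seq_cat /= => /andP[-> Hq]; rewrite {1}/step_rel leqnn /=.
by case: q Hq => [|y q] //=; rewrite /step_rel; lia.
Qed.

(** * Counting and selecting positions *)

Lemma letter_suffix (w : seq nat) c :
  [seq letter w i | i <- iota c.+1 (size w - c)] = drop c w.
Proof.
apply: (@eq_from_nth _ 0); rewrite size_map size_iota ?size_drop // => i lti.
by rewrite (nth_map 0) ?size_iota // nth_iota // nth_drop /letter addSn.
Qed.

Lemma count_letter_suffix Q w c :
  count (fun i => Q (letter w i)) (iota c.+1 (size w - c)) = count Q (drop c w).
Proof. by rewrite -letter_suffix count_map. Qed.

Lemma count_letter Q w :
  count (fun i => Q (letter w i)) (positions w) = count Q w.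
Proof. by have := count_letter_suffix Q w 0; rewrite subn0 drop0. Qed.

Lemma mem_letter (w : seq nat) i : 0 < i <= size w -> letter w i \in w.
Proof. by case: i => // i Hi; apply: mem_nth. Qed.

Lemma mem_positions w i : (i \in positions w) = (0 < i <= size w).
Proof. by rewrite mem_iota add1n ltnS. Qed.

Lemma mem_drop_letter (w : seq nat) c (y : nat) :
  y \in drop c w -> exists2 i, c < i <= size w & y = letter w i.
Proof.
rewrite -letter_suffix => /mapP[i]; rewrite mem_iota => Hi ->.
by exists i => //; lia.
Qed.

Lemma iota_split n c : 0 < c <= n ->
  iota 1 n = iota 1 c.-1 ++ c :: iota c.+1 (n - c).
Proof.
move=> Hc; have -> : n = c.-1 + (n - c).+1 by lia.
by rewrite iotaD /= add1n prednK; [congr (_ ++ _ :: iota _ _); lia | lia].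
Qed.

(** In decreasing order, the rank of a selected position is the number of selected positions to its
    right. This turns a rank into a count of letters. *)
Lemma nth_rev_filter_iota (P : pred nat) n a (s := [seq i <- iota 1 n | P i]) :
  a < size s ->
  exists c, [/\ nth 0 (rev s) a = c, 0 < c <= n, P c
              & count P (iota c.+1 (n - c)) = a].
Proof.
move=> lta; set c := nth 0 (rev s) a; exists c.
have cs : c \in s by rewrite -mem_rev mem_nth ?size_rev.
have [Pc Hc] : P c /\ 0 < c <= n.
  by move: cs; rewrite mem_filter mem_iota => /andP[-> ?]; split=> //; lia.
split=> //.
have us : uniq (rev s) by rewrite rev_uniq filter_uniq // iota_uniq.
rewrite -[RHS](index_uniq 0 (s := rev s)) ?size_rev // -/c /s.
rewrite (iota_split Hc) filter_cat /= Pc rev_cat rev_cons cat_rcons index_cat.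
rewrite mem_rev mem_filter mem_iota ltnn andbF /= eqxx addn0 size_rev.
by rewrite size_filter.
Qed.

(** * Maximal letters and their last block *)

Lemma leq_maxval w : all (leq^~ (maxval w)) w.
Proof.
elim: w => //= x w IH; rewrite leq_maxl /=.
by apply: sub_all IH => y /= Hy; rewrite leq_max Hy orbT.
Qed.

Lemma mem_maxval (w : seq nat) : w != [::] -> maxval w \in w.
Proof.
elim: w => //= x [|y w] IH _ /=; first by rewrite maxn0 mem_head.
case: (leqP x (maxval (y :: w))) => _; last exact: mem_head.
by rewrite inE IH ?orbT.
Qed.

Lemma maxvalP (w : seq nat) x : all (leq^~ x) w -> x \in w -> maxval w = x.
Proof.
move=> /allP Hw xw; apply/eqP; rewrite eqn_leq (allP (leq_maxval w) _ xw) andbT.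
by apply: Hw; apply: mem_maxval; case: (w) xw.
Qed.

(** Along a path from [x], it forces the letters [x] to form a prefix. Stated as a transitive
    relation, it also compares letters that are not adjacent. *)
Definition block_rel (x y z : nat) : bool := (z == x) ==> (y == x).

Lemma block_rel_trans x : transitive (block_rel x).
Proof.
by move=> b a c; rewrite /block_rel; case: (c == x); case: (b == x).
Qed.

(* In [p ++ cap p :: q], the letter [cap p] is maximal and starts the last block
   of maximal letters; it differs from the last letter of [p] by definition. *)
Definition last_block (p q : seq nat) : bool :=
  all (leq^~ (cap p)) (p ++ q) && path (block_rel (cap p)) (cap p) q.

Definition stat (p q : seq nat) : nat :=
  count (pred1 (cap p)) (p ++ q) + count (fun y => y.+1 == cap p) q.

Lemma path_block_notin (x y : nat) (q : seq nat) : x \notin q -> path (block_rel x) y q.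
Proof.
elim: q y => //= z q IH y; rewrite inE negb_or eq_sym => /andP[zx xq].
by rewrite {1}/block_rel (negbTE zx) IH.
Qed.

Lemma last_block_split (w : seq nat) (x : nat) : x \in w ->
  exists p q, [/\ w = p ++ x :: q, cap p != x.+1 & path (block_rel x) x q].
Proof.
elim: w => // y w IH; case: (boolP (x \in w)) => [xw _|xw].
  have [p [q [-> Hp Hq]]] := IH xw.
  (* Only an empty [p] leaves a choice: the new head either extends the block or becomes the letter
     before it. *)
  case: p Hp => [|z p] Hp.
    case: (eqVneq y x) => [->|yx].
      by exists [::], (x :: q); split=> //=; rewrite Hq /block_rel eqxx.
    by exists [:: y], q; split=> //; rewrite /cap /= eqSS.
  by exists (y :: z :: p), q.
rewrite inE (negbTE xw) orbF => /eqP <-; exists [::], w; split=> //.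
exact: path_block_notin.
Qed.

(** The step condition gives [x <= cap p], maximality gives [cap p <= x.+1], and the start of a
    block rules out [x.+1]. *)
Lemma area_seq_last_block w : is_area_seq w -> w != [::] ->
  exists p q, w = p ++ cap p :: q /\ last_block p q.
Proof.
move=> Aw /mem_maxval; set x := maxval w => /last_block_split[p [q [Ew Hp Hq]]].
have Hw := leq_maxval w; rewrite -/x {1}Ew all_cat /= in Hw.
have capx : cap p = x.
  have : x <= cap p.
    by move: Aw; rewrite Ew area_seq_cat /= /step_rel ltnS => /and3P[].
  have : cap p <= x.+1.
    case/lastP: p {Ew Hp} Hw => [|p y] //; rewrite cap_rcons all_rcons ltnS.
    by case/andP=> /andP[].
  by move: Hp; lia.
exists p, q; rewrite capx; split=> //.
by rewrite /last_block capx Hq andbT all_cat; case/and3P: Hw => -> _ ->.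
Qed.

Lemma letter_size_neq_cap p q :
  (size p == 0) || (letter (p ++ q) (size p) != cap p).
Proof.
case/lastP: p => [|p y] //; rewrite size_rcons /letter nth_cat size_rcons ltnSn.
by rewrite nth_rcons ltnn eqxx cap_rcons neq_ltn ltnSn.
Qed.

(** * Admissible positions of a word split at its last maximal block *)

Section LastBlock.

Variables p q : seq nat.
Hypothesis Hpq : last_block p q.
Let x := cap p.
Let v := p ++ x :: q.

Lemma last_block_maxval : maxval v = x.
Proof.
apply: maxvalP; last by rewrite mem_cat mem_head orbT.
by case/andP: Hpq; rewrite !all_cat /= leqnn.
Qed.

Lemma last_block_letter : letter v (size p).+1 = x.
Proof. by rewrite /letter nth_cat ltnn subnn. Qed.

Lemma last_block_letter_eq i j :
  size p < i < j -> j <= size v -> letter v j = x -> letter v i = x.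
Proof.
rewrite /v size_cat /= => /andP[pi ij] jv; rewrite /letter !nth_cat.
have -> : (i.-1 < size p) = false by lia.
have -> : (j.-1 < size p) = false by lia.
move=> vj; case/andP: Hpq => _ Hq.
have Hs : sorted (block_rel x) (x :: q) by [].
have := sorted_ltn_nth (block_rel_trans (x := x)) 0 Hs.
move=> /(_ (i.-1 - size p) (j.-1 - size p)); rewrite !inE /=.
rewrite /block_rel vj eqxx /= => H; apply/eqP/H; lia.
Qed.

Lemma positions_last_block :
  positions v = iota 1 (size p) ++ (size p).+1 :: iota (size p).+2 (size q).
Proof. by rewrite /positions size_cat iotaD. Qed.

Lemma last_block_i0 : i0 v = (size p).+1.
Proof.
rewrite /i0 /block_starts last_block_maxval positions_last_block filter_cat /=.
rewrite last_block_letter eqxx /=.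
rewrite eqSS letter_size_neq_cap.
(* No block starts later: a maximal letter further right has a maximal letter just before it. *)
rewrite [X in _ :: X](_ : _ = [::]) ?cats1 ?last_rcons //.
apply/eqP; rewrite -(negbK (_ == _)) -has_filter; apply/hasPn => j.
rewrite mem_iota => Hj; apply/negP => /andP[/eqP vj /orP[/eqP|/negP[]]].
  by lia.
case: (eqVneq j.-1 (size p).+1) => [->|Hj']; first by rewrite last_block_letter.
by apply/eqP/(@last_block_letter_eq _ j); rewrite // ?/v ?size_cat /=; lia.
Qed.

Lemma last_block_size_Maxb : size (Maxb v) = (count (pred1 x) (p ++ q)).+1.
Proof.
rewrite size_filter last_block_maxval (count_letter (pred1 x)).
by rewrite !count_cat /= eqxx addnCA.
Qed.

(** Positions in [p] are excluded by the marked letter to their right. After a letter of [q] below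
    [x], no [x] can occur, so every [x - 1] in [q] counts. *)
Lemma last_block_size_Maxa : size (Maxa v) = count (fun y => y.+1 == x) q.
Proof.
rewrite size_filter last_block_maxval.
have sv : size v = (size p + size q).+1 by rewrite /v size_cat /= addnS.
rewrite {2}positions_last_block count_cat /=.
rewrite last_block_letter eqn_leq ltnn /= add0n.
rewrite (_ : count _ (iota 1 _) = 0).
  have {2}-> : q = drop (size p).+1 v.
    by rewrite /v -cat_rcons drop_size_cat // size_rcons.
  rewrite -count_letter_suffix add0n.
  rewrite (_ : size v - _ = size q); last by lia.
  apply: eq_in_count => i; rewrite mem_iota => Hi; rewrite andbC.
  case: eqP => Ei; last by rewrite andbF.
  rewrite andbT; apply/allP => j; rewrite mem_positions => Hj; apply/implyP => ij.
  have vjx : letter v j <= x.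
    by rewrite -last_block_maxval (allP (leq_maxval v)) // mem_letter.
  rewrite ltn_neqAle vjx andbT; apply/eqP => vj.
  by have := @last_block_letter_eq i j; move=> /(_ _ _ vj) => H; lia.
apply/eqP; rewrite -leqn0 leqNgt -has_count; apply/hasPn => i.
rewrite mem_iota => Hi; apply/negP => /andP[_ /allP].
move=> /(_ (size p).+1); rewrite mem_positions last_block_letter ltnn implybF.
by rewrite sv; lia.
Qed.

(** Beyond [stat p q], one position comes from the marked letter itself and one from the final
    [(i0 v).-1]. *)
Lemma last_block_size_adm : size (adm_positions v) = (stat p q).+2.
Proof.
have -> : adm_positions v = rev (Maxb v) ++ rev (Maxa v) ++ [:: (i0 v).-1].
  by rewrite /v; case: (p).
rewrite !size_cat !size_rev last_block_size_Maxb last_block_size_Maxa /=.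
by rewrite /stat addn1 addSn addnS.
Qed.

End LastBlock.

(** * Dinv under insertion *)

Lemma dinv_cons x w :
  dinv (x :: w) = count (fun y => (y == x) || (y.+1 == x)) w + dinv w.
Proof.
rewrite /dinv /positions /= -[2]/(1 + 1) iotaDl -map_comp; congr (_ + _).
  rewrite /dinv_at /positions /= add0n -[2]/(1 + 1) iotaDl count_map.
  rewrite -[RHS](count_letter _ w).
  by apply: eq_in_count => -[|i]; rewrite mem_iota.
congr sumn; apply/eq_in_map => -[|i]; rewrite mem_iota // => _.
rewrite /dinv_at /positions /= add0n -[2]/(1 + 1) iotaDl count_map.
by apply: eq_in_count => -[|j]; rewrite mem_iota.
Qed.

Lemma dinv_insert p x q :
  dinv (p ++ x :: q) =
    dinv (p ++ q) + count (fun y => (y == x) || (y.+1 == x)) q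
                  + count (fun y => (y == x) || (y == x.+1)) p.
Proof.
elim: p => [|y p IH] /=; first by rewrite dinv_cons addn0 addnC.
rewrite !dinv_cons IH !count_cat /= (eq_sym x y) (eq_sym x.+1 y); lia.
Qed.

(** Maximality leaves no letter [(cap p).+1] in [p], and the two conditions counted in [q] are
    disjoint, so their counts add. *)
Lemma dinv_last_block p q : last_block p q ->
  dinv (p ++ cap p :: q) = dinv (p ++ q) + stat p q.
Proof.
case/andP; rewrite all_cat => /andP[/allP Hp /allP Hq] _.
rewrite dinv_insert /stat count_cat -addnA; congr (_ + _).
rewrite (_ : count _ p = count (pred1 (cap p)) p); last first.
  by apply: eq_in_count => y /Hp /= Hy; rewrite (ltn_eqF (n := _.+1)) ?orbF.
rewrite addnC -addnA; congr (_ + _).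
rewrite -count_predUI [X in _ = _ + X](eq_count (a2 := pred0)).
  by rewrite count_pred0 addn0.
by move=> y /=; case: eqP => //= ->; rewrite eq_sym ltn_eqF.
Qed.

(** * Insertion at an admissible position *)

(** With m the old maximum, a position of [Maxb] creates the only letter m + 1, a position of [Maxa]
    creates an m with no m after it, and the final position prolongs the last block of m to the
    left. *)
Lemma psi_step_last_block v a :
    is_area_seq v -> a < size (adm_positions v) ->
  exists p q, [/\ v = p ++ q, psi_step v a = p ++ cap p :: q,
                  last_block p q & stat p q = a].
Proof.
move=> Av; case: (eqVneq v [::]) => [-> | v0].
  by rewrite /psi_step; case: a => // _; exists [::], [::].
have Eadm : adm_positions v = rev (Maxb v) ++ rev (Maxa v) ++ [:: (i0 v).-1].
  by case: (v) v0.
have Hmax := leq_maxval v.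
have split_at c : c <= size v -> nth 0 (adm_positions v) a = c ->
    last_block (take c v) (drop c v) -> stat (take c v) (drop c v) = a ->
  exists p q, [/\ v = p ++ q, psi_step v a = p ++ cap p :: q,
                  last_block p q & stat p q = a].
- move=> lec Ec Hb Hs; exists (take c v), (drop c v).
  by rewrite cat_take_drop /psi_step Ec ins_split.
rewrite Eadm !size_cat !size_rev /=.
case: (ltnP a (size (Maxb v))) => [lta _ | lea lta'].
- have [c [Ec Hc /eqP Lc Na]] := nth_rev_filter_iota lta.
  have Ecap : cap (take c v) = (maxval v).+1 by rewrite cap_take // Lc.
  apply: (split_at c); first by case/andP: Hc.
  + by rewrite Eadm nth_cat size_rev lta.
  + rewrite /last_block Ecap cat_take_drop; apply/andP; split.
      by apply: sub_all Hmax => y /leqW.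
    apply: path_block_notin; apply/negP => /mem_drop /(allP Hmax).
    by rewrite ltnn.
  (* The new maximum does not occur in [v], so only the letters m to the right of [c] contribute. *)
  + rewrite /stat Ecap cat_take_drop -[RHS]Na -[RHS]add0n; congr (_ + _).
      apply/eqP; rewrite -leqn0 leqNgt -has_count; apply/hasPn => y /(allP Hmax).
      by rewrite /= neq_ltn ltnS => ->.
    by rewrite (count_letter_suffix (pred1 (maxval v))); apply: eq_count.
case: (ltnP (a - size (Maxb v)) (size (Maxa v))) => [lta | lea'].
- have [c [Ec Hc /andP[/eqP Lc Hlt] Na]] := nth_rev_filter_iota lta.
  have Ecap : cap (take c v) = maxval v by rewrite cap_take.
  have Hlt' j : c < j <= size v -> letter v j < maxval v.
    move=> Hj; apply: (implyP (allP Hlt _ _)); last by case/andP: Hj.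
    by rewrite mem_positions; lia.
  apply: (split_at c); first by case/andP: Hc.
  + by rewrite Eadm nth_cat size_rev ltnNge lea /= nth_cat size_rev lta.
  + rewrite /last_block Ecap cat_take_drop Hmax; apply: path_block_notin.
    by apply/negP => /mem_drop_letter[j /Hlt' + Ej]; rewrite -Ej ltnn.
  (* All of [Maxb] precedes in the order; the rank within [Maxa] is the number of letters m - 1 to
     the right of [c]. *)
  + rewrite /stat Ecap cat_take_drop -(count_letter (pred1 _)) -size_filter.
    rewrite -[RHS](subnKC lea) -Na; congr (_ + _).
    rewrite -count_letter_suffix; apply: eq_in_count => j.
    rewrite mem_iota => Hj; case: eqP => //= _; apply/esym/allP => k.
    rewrite mem_positions => Hk; apply/implyP => jk; apply: Hlt'; lia.
have Ea : a = size (Maxb v) + size (Maxa v) by lia.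
have [p [q [Ev Hpq]]] := area_seq_last_block Av v0.
(* The old start of the last block moves into the suffix, right after the inserted copy. *)
exists p, (cap p :: q); split=> //.
- rewrite /psi_step Eadm catA nth_cat size_cat !size_rev -Ea ltnn subnn /=.
  by rewrite {1}Ev last_block_i0 //= Ev ins_cat.
- case/andP: Hpq; rewrite /last_block !all_cat /= leqnn /block_rel eqxx /=.
  by move=> -> ->.
- rewrite Ea Ev last_block_size_Maxb // last_block_size_Maxa // /stat.
  rewrite !count_cat /= eqxx.
  have -> : ((cap p).+1 == cap p) = false by lia.
  lia.
Qed.

(** * Deletion of the inserted letter *)

Lemma area_seq_del p q : last_block p q ->
  is_area_seq (p ++ cap p :: q) -> is_area_seq (p ++ q).
Proof.
rewrite /last_block all_cat !area_seq_cat /= => /andP[/andP[_ Hq] _].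
case/and3P=> -> _ /=; case: q Hq => [|y q] //= /andP[Hy _] /andP[_ ->].
by rewrite /step_rel ltnS Hy.
Qed.

(** If [cap p] does not occur in [p ++ q], the position lies in [Maxb]. Otherwise [cap p] is the
    maximum, and the position is [i0 - 1] or lies in [Maxa] according to whether [q] starts with
    it. *)
Lemma last_block_adm p q : last_block p q ->
  size p \in adm_positions (p ++ q).
Proof.
move=> /andP[Hle Hq].
case: (eqVneq (p ++ q) [::]) => [|pq0].
  by case: (p) => // ->.
have -> : adm_positions (p ++ q)
  = rev (Maxb (p ++ q)) ++ rev (Maxa (p ++ q)) ++ [:: (i0 (p ++ q)).-1].
  by case: (p ++ q) pq0.
rewrite !mem_cat !mem_rev !mem_filter mem_seq1 mem_positions size_cat leq_addr.
have letter_p : 0 < size p -> (letter (p ++ q) (size p)).+1 = cap p.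
  move=> p0; rewrite -cap_take ?take_size_cat // p0 size_cat leq_addr //.
case: (boolP (cap p \in p ++ q)) => [xpq | xpq].
  have mx : maxval (p ++ q) = cap p by apply: maxvalP.
  case: q Hle Hq pq0 xpq mx letter_p => [|y q] Hle Hq pq0 xpq mx letter_p.
    have p0 : 0 < size p by case: (p) pq0.
    rewrite mx letter_p // eqxx p0 /=; apply/orP; right; apply/orP; left.
    rewrite andbT; apply/allP => j; rewrite mem_positions cats0.
    by rewrite (leqNgt j) => /andP[_ /negbTE ->].
  case: (eqVneq y (cap p)) => [Ey | yx].
    rewrite Ey last_block_i0 ?eqxx ?orbT //.
    move: Hle Hq; rewrite /last_block Ey !all_cat /= leqnn /=.
    by move=> -> /andP[].
  (* Since the block stops before [y], it cannot resume in [q]. *)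
  have xq : cap p \notin y :: q.
    have Hs : sorted (block_rel (cap p)) (y :: q) by case/andP: Hq.
    have := order_path_min (block_rel_trans (x := cap p)) Hs.
    move/allP => H; rewrite inE eq_sym (negbTE yx) /=; apply/negP => /H.
    by rewrite /block_rel eqxx (negbTE yx).
  have p0 : 0 < size p by case: (p) xpq xq => //= ->.
  rewrite mx letter_p // eqxx p0 /=; apply/orP; right; apply/orP; left.
  rewrite andbT; apply/allP => j; rewrite mem_positions => Hj; apply/implyP => pj.
  have vj : letter (p ++ y :: q) j \in y :: q.
    rewrite /letter nth_cat ifN; last by lia.
    have jq : j.-1 - size p < size (y :: q) by move: Hj; rewrite size_cat; lia.
    exact: mem_nth.
  have := allP Hle _ (mem_letter Hj); rewrite leq_eqVlt => /orP[/eqP E|//].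
  by rewrite -E vj in xq.
have Hlt y : y \in p ++ q -> y < cap p.
  move=> ypq; rewrite ltn_neqAle (allP Hle) // andbT.
  by apply: contraNneq xpq => <-.
(* For empty [p], [cap p] is 0 and no letter lies strictly below it. *)
have p0 : 0 < size p.
  by case: (p) Hlt pq0 => //= Hlt; case: (q) Hlt => // y q' /(_ y (mem_head _ _)).
apply/orP; left; rewrite p0 andbT -eqSS letter_p // eqn_leq.
rewrite Hlt ?mem_maxval // andbT -(letter_p p0) ltnS (allP (leq_maxval _)) //.
by rewrite mem_letter // p0 size_cat leq_addr.
Qed.

(** * Properties of [psi] *)

(** The two claims are proved together: the count for [u] makes the next letter an admissible rank.
    For the empty word, [cap] is 0, matching the single position 0. *)
Lemma psi_area_seq w : is_area_seq w ->
  is_area_seq (psi w) /\ size (adm_positions (psi w)) = (cap w).+1.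
Proof.
elim/last_ind: w => [|u a IH] //; rewrite area_seq_rcons => /andP[/IH[Au Su] au].
rewrite psi_rcons -/(psi_step _ a) cap_rcons.
have [|p [q [Eu -> Hb Hs]]] := psi_step_last_block Au (a := a).
  by rewrite Su ltnS.
by split; [apply: area_seq_ins; rewrite -Eu | rewrite last_block_size_adm // Hs].
Qed.

Lemma psi_rcons_last_block u a : is_area_seq (rcons u a) ->
  exists p q, [/\ psi u = p ++ q, psi (rcons u a) = p ++ cap p :: q,
                  last_block p q & stat p q = a].
Proof.
rewrite area_seq_rcons => /andP[/psi_area_seq[Au Su] au].
rewrite psi_rcons -/(psi_step _ a).
by apply: psi_step_last_block; rewrite // Su ltnS.
Qed.

Lemma size_psi w : is_area_seq w -> size (psi w) = size w.
Proof.
elim/last_ind: w => [|u a IH] // Aua.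
have [p [q [Eu -> _ _]]] := psi_rcons_last_block Aua.
move: Aua; rewrite area_seq_rcons => /andP[/IH + _].
by rewrite Eu !size_cat size_rcons /= addnS => ->.
Qed.

Lemma dinv_psi w : is_area_seq w -> dinv (psi w) = area w.
Proof.
elim/last_ind: w => [|u a IH] // Aua.
have [p [q [Eu -> Hb Hs]]] := psi_rcons_last_block Aua.
move: Aua; rewrite area_seq_rcons => /andP[/IH + _].
by rewrite dinv_last_block // Hs Eu /area sumn_rcons => ->.
Qed.

Lemma psi_inj w1 w2 :
  is_area_seq w1 -> is_area_seq w2 -> psi w1 = psi w2 -> w1 = w2.
Proof.
elim/last_ind: w1 w2 => [|u1 a1 IH] w2 A1 A2 E12.
  by apply/esym/size0nil; rewrite -size_psi // -E12.
case/lastP: w2 A2 E12 => [|u2 a2] A2 E12.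
  by have := congr1 size E12; rewrite !size_psi // size_rcons.
have [p1 [q1 [Eu1 Ew1 Hb1 Hs1]]] := psi_rcons_last_block A1.
have [p2 [q2 [Eu2 Ew2 Hb2 Hs2]]] := psi_rcons_last_block A2.
move: E12; rewrite Ew1 Ew2 => E12.
(* The common image determines the inserted position through [i0], hence both splittings agree;
   [stat] then recovers the last letter. *)
have : (size p1).+1 = (size p2).+1 by rewrite -(last_block_i0 Hb1) -(last_block_i0 Hb2) E12.
case=> /eqP Esz; move/eqP: E12.
rewrite eqseq_cat; last exact/eqP.
rewrite eqseq_cons => /and3P[/eqP Ep _ /eqP Eq].
rewrite -Hs1 -Hs2 Ep Eq (IH u2) //.
- by move: A1; rewrite area_seq_rcons => /andP[].
- by move: A2; rewrite area_seq_rcons => /andP[].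
- by rewrite Eu1 Eu2 Ep Eq.
Qed.

Lemma psi_surj v : is_area_seq v -> exists2 w, is_area_seq w & psi w = v.
Proof.
have [n] := ubnP (size v); elim: n v => // n IH v ltn Av.
case: (eqVneq v [::]) => [->|v0]; first by exists [::].
have [p [q [Ev Hb]]] := area_seq_last_block Av v0.
have Apq : is_area_seq (p ++ q) by apply: area_seq_del; rewrite // -Ev.
have [|u Au Eu] := IH _ _ Apq.
  by move: ltn; rewrite Ev !size_cat /= addnS !ltnS.
(* The letter to append is the rank of the deleted position among the admissible ones; their number
   bounds it by [cap u]. *)
have := last_block_adm Hb; rewrite -Eu => /(nthP 0)[a lta Ea].
exists (rcons u a); last by rewrite psi_rcons Ea Eu ins_cat.
by rewrite area_seq_rcons Au -ltnS; have [_ <-] := psi_area_seq Au.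
Qed.

Theorem theorem2p3 :
  [/\ forall (u : seq nat) (a : nat),
        is_area_seq (rcons u a) -> a < size (adm_positions (psi u)),
      bijection_on (fun w : seq nat => is_area_seq w) psi,
      forall n : nat,
        bijection_on (fun w : seq nat => is_area_seq w /\ size w = n) psi
    & forall w : seq nat, is_area_seq w -> dinv (psi w) = area w].
Proof.
split.
- by move=> u a; rewrite area_seq_rcons => /andP[/psi_area_seq[_ ->]]; rewrite ltnS.
- split; [by move=> w /psi_area_seq[] | exact: psi_inj | exact: psi_surj].
- move=> n; split.
  + by move=> w [Aw <-]; rewrite size_psi //; case: (psi_area_seq Aw).
  + by move=> w1 w2 [A1 _] [A2 _]; apply: psi_inj.
  + move=> v [/psi_surj[w Aw <-] Sw]; exists w => //.
    by rewrite -Sw size_psi.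
- exact: dinv_psi.
Qed.
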